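(* Let $n\geq 1$ and $m\geq 1$ with $(n,m)\notin\{(1,1),(1,2),(2,1),(2,2),(3,3),(3,4),(4,3)\}$. If there exists an $n\times m$ min-$2$TDS matrix with no all-$0$ rows and no all-$0$ columns, then there exists an $n\times m$ min-$2$TDS matrix $M$ all of whose components, up to permutations of rows and columns, are $J(1,3)$ or $J(3,1)$, except possibly for (i) exactly one $J(x,1)$ component with $4\leq x\leq 7$; or (ii) exactly one $J(1,y)$ component with $4\leq y\leq 7$; or (iii) exactly one $J(x,1)$ component with $4\leq x\leq 5$ and exactly one $J(1,y)$ component with $4\leq y\leq 5$. Further, the number of ones in $M$ is $\lceil 3(n+m)/4\rceil+1$ if $m\equiv 3n+4 \pmod 8$, and $\lceil 3(n+m)/4\rceil$ otherwise.
   Context: For an $n\times m$ $(0,1)$-matrix $M=(m_{ij})$, define $\kappa(i,j)$ as the $i$-th row sum plus the $j$-th column sum minus $2m_{ij}$; $M$ is a $k$TDS matrix if $\kappa(i,j)\geq k$ for all cells. A min-$k$TDS matrix is an $n\times m$ $k$TDS matrix whose number of ones is the minimum possible among all $n\times m$ $k$TDS matrices (this minimum equals $\gamma_{\times k,t}(K_n\Box K_m)$). Given $M$, let $\Gamma(M)$ be the graph whose vertices are the positions of the ones of $M$, two ones adjacent iff they lie in the same row or column with no other one strictly between them. The components of $M$ are the connected components of $\Gamma(M)$, each identified with the submatrix of $M$ on the rows and columns its ones meet. $J(x,y)$ denotes the $x\times y$ all-ones matrix. *)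

(* Defs.v *)
From HB Require Import structures.
From mathcomp Require Import all_boot all_order all_algebra.

Set Implicit Arguments.
Unset Strict Implicit.
Unset Printing Implicit Defensive.

(* A (0,1)-matrix is a boolean matrix; entries are coerced to
   nat when they are summed. *)

Definition row_sum n m (M : 'M[bool]_(n, m)) (i : 'I_n) : nat :=
  \sum_(j < m) M i j.

Definition col_sum n m (M : 'M[bool]_(n, m)) (j : 'I_m) : nat :=
  \sum_(i < n) M i j.

(* The subtraction is never truncated: if M i j = 1, then both sums are
   at least 1. *)
Definition kappa n m (M : 'M[bool]_(n, m)) (i : 'I_n) (j : 'I_m) : nat :=
  row_sum M i + col_sum M j - 2 * M i j.

Definition is_kTDS k n m (M : 'M[bool]_(n, m)) : Prop :=
  forall i j, k <= kappa M i j.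

Definition ones n m (M : 'M[bool]_(n, m)) : {set 'I_n * 'I_m} :=
  [set p | M p.1 p.2].

Definition is_min_kTDS k n m (M : 'M[bool]_(n, m)) : Prop :=
  is_kTDS k M /\
  forall M' : 'M[bool]_(n, m), is_kTDS k M' -> #|ones M| <= #|ones M'|.

Definition no_zero_row n m (M : 'M[bool]_(n, m)) : Prop :=
  forall i, exists j, M i j.

Definition no_zero_col n m (M : 'M[bool]_(n, m)) : Prop :=
  forall j, exists i, M i j.

Definition strictly_between (a b c : nat) : bool :=
  (a < b < c) || (c < b < a).

(* The graph Gamma(M).  It is given as a relation on all positions, but only
   positions of ones have neighbours. *)
Definition Gamma n m (M : 'M[bool]_(n, m)) : rel ('I_n * 'I_m) :=
  fun p q =>
    [&& p \in ones M, q \in ones M, p != q &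
      ((p.1 == q.1) &&
         [forall j : 'I_m, strictly_between p.2 j q.2 ==> ~~ M p.1 j]) ||
      ((p.2 == q.2) &&
         [forall i : 'I_n, strictly_between p.1 i q.1 ==> ~~ M i p.2])].

Definition components n m (M : 'M[bool]_(n, m)) : {set {set 'I_n * 'I_m}} :=
  [set [set q in ones M | connect (Gamma M) p q] | p in ones M].

Definition comp_rows n m (C : {set 'I_n * 'I_m}) : {set 'I_n} :=
  [set p.1 | p in C].

Definition comp_cols n m (C : {set 'I_n * 'I_m}) : {set 'I_m} :=
  [set p.2 | p in C].

Definition comp_mx n m (M : 'M[bool]_(n, m)) (C : {set 'I_n * 'I_m}) :
    'M[bool]_(#|comp_rows C|, #|comp_cols C|) :=
  mxsub (fun i : 'I_#|comp_rows C| => enum_val i)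
        (fun j : 'I_#|comp_cols C| => enum_val j) M.

Definition J x y : 'M[bool]_(x, y) := const_mx true.

(* Equality up to permutations of rows and columns, for matrices whose
   dimensions are not syntactically equal: the bijections force n1 = n2 and
   m1 = m2. *)
Definition perm_equiv n1 m1 n2 m2
    (A : 'M[bool]_(n1, m1)) (B : 'M[bool]_(n2, m2)) : Prop :=
  exists (f : 'I_n1 -> 'I_n2) (g : 'I_m1 -> 'I_m2),
    [/\ bijective f, bijective g & A = mxsub f g B].

Definition is_J n m (M : 'M[bool]_(n, m)) (C : {set 'I_n * 'I_m}) x y : Prop :=
  perm_equiv (comp_mx M C) (J x y).

Definition all_J13_J31_except n m (M : 'M[bool]_(n, m))
    (E : {set {set 'I_n * 'I_m}}) : Prop :=
  forall C, C \in components M :\: E -> is_J M C 1 3 \/ is_J M C 3 1.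

(* Since J(1,3) and J(3,1) are never of the exceptional shapes, the
   exceptional components named below are the only ones of their kind. *)
Definition Jcomponents n m (M : 'M[bool]_(n, m)) : Prop :=
  [\/ all_J13_J31_except M set0,
      exists C x, [/\ C \in components M, 4 <= x <= 7, is_J M C x 1
                    & all_J13_J31_except M [set C]],
      exists C y, [/\ C \in components M, 4 <= y <= 7, is_J M C 1 y
                    & all_J13_J31_except M [set C]]
    | exists C D x y, [/\ C \in components M /\ D \in components M,
                          4 <= x <= 5 /\ 4 <= y <= 5,
                          is_J M C x 1, is_J M D 1 y
                        & all_J13_J31_except M [set C; D]]].

(* Main.v *)
Require Import Defs.
From HB Require Import structures.
From mathcomp Require Import all_boot all_order all_algebra.
From mathcomp Require Import zify lra.

Set Implicit Arguments.
Unset Strict Implicit.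
Unset Printing Implicit Defensive.

Import GRing.Theory Num.Theory.

(* Regard rows and columns as vertices and ones as edges of a bipartite graph:
   a matrix without zero rows or columns is 2TDS iff the degrees of the ends of
   every edge add up to at least 4.  Let a vertex of degree d give weight 6, 3
   or 2 to each of its edges when d = 1, d = 2 or d >= 3.  It gives at least 6
   in total while an edge receives at most 8, so 3(n+m) <= 4N for N ones;
   equality forces all edges to join degrees 1 and 3, whence 3n = m mod 8.
   A minimum matrix moreover has N <= 2n and N <= 2m, because two full columns
   (or rows) are 2TDS.  Under these inequalities disjoint unions of stars
   J(1,3), J(3,1) and at most two stars with 4 or 5 ones reach the lower bound,
   except in the sizes excluded by hypothesis and in 2 x 3 and 3 x 2, where
   enumeration shows that no 2TDS matrix without zero lines has N <= 4. *)

(** * Disjoint unions of complete blocks and their components *)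

(** The disjoint union of the ['I_(x k)] has [n] elements; numbering it by ['I_n] and reading off
    tags gives the labels. *)
Lemma exists_labelling (L : finType) (x : L -> nat) n :
  n = \sum_k x k ->
  exists r : 'I_n -> L, forall k, #|[set i | r i == k]| = x k.
Proof.
move=> nE; pose T := {k : L & 'I_(x k)}.
have cT : #|{: T}| = n.
  by rewrite card_tagged sumnE big_map big_enum nE; apply: eq_bigr => k _; rewrite card_ord.
pose f (i : 'I_n) : T := enum_val (cast_ord (esym cT) i).
pose g (u : T) : 'I_n := cast_ord cT (enum_rank u).
have fK : cancel f g by move=> i; rewrite /g enum_valK cast_ordKV.
have gK : cancel g f by move=> u; rewrite /f cast_ordK enum_rankK.
exists (fun i => tag (f i)) => k.
rewrite -[RHS]card_ord -cardsT.
have inj : injective (fun o : 'I_(x k) => g (Tagged (fun l => 'I_(x l)) o)).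
  by move=> o o' /(can_inj gK) /eqP; rewrite eq_Tagged => /eqP.
rewrite -(card_imset _ inj); apply: eq_card => i.
apply/idP/imsetP.
  rewrite inE => /eqP tE; case E: (f i) tE => [l o] /= tE.
  by subst l; exists o => //; apply: (can_inj fK); rewrite gK.
by case=> o _ ->; rewrite inE gK.
Qed.

(** Serves rows and columns alike. Induction on the distance of [a] and [b], written as a sum of two
    truncated differences: either [e] applies directly, or a point of [P] in between splits the
    path. *)
Lemma connect_consecutive (T : finType) (e : rel T) k (P : pred 'I_k)
    (g : 'I_k -> T) :
  (forall a b, P a -> P b -> a != b ->
     [forall c : 'I_k, strictly_between a c b ==> ~~ P c] -> e (g a) (g b)) ->
  forall a b, P a -> P b -> connect e (g a) (g b).
Proof.
move=> He a b.
have [d] := ubnP ((a - b) + (b - a)); elim: d a b => // d IH a b dE Pa Pb.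
have [->|ab] := eqVneq a b; first exact: connect0.
have [C|/forallPn[c]] := boolP [forall c : 'I_k, strictly_between a c b ==> ~~ P c].
  exact/connect1/He.
rewrite negb_imply negbK /strictly_between => /andP[acb Pc].
apply: (@connect_trans _ _ (g c)); apply: IH => //; lia.
Qed.

Lemma connect_Gamma_row n m (M : 'M[bool]_(n, m)) i a b :
  M i a -> M i b -> connect (Gamma M) (i, a) (i, b).
Proof.
apply: (@connect_consecutive _ _ _ (M i) (fun j => (i, j))) => {}a {}b Ma Mb ab H.
by rewrite /Gamma !inE /= Ma Mb xpair_eqE eqxx ab H.
Qed.

Lemma connect_Gamma_col n m (M : 'M[bool]_(n, m)) j a b :
  M a j -> M b j -> connect (Gamma M) (a, j) (b, j).
Proof.
apply: (@connect_consecutive _ _ _ (M^~ j) (fun i => (i, j))) => {}a {}b Ma Mb ab H.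
by rewrite /Gamma !inE /= Ma Mb xpair_eqE eqxx andbT ab H orbT.
Qed.

Lemma perm_equiv_J p q (A : 'M[bool]_(p, q)) x y :
  p = x -> q = y -> (forall i j, A i j) -> perm_equiv A (J x y).
Proof.
move=> <- <- HA; exists id, id; split; try by exists id.
by apply/matrixP => i j; rewrite !mxE HA.
Qed.

Lemma card_ones n m (M : 'M[bool]_(n, m)) : #|ones M| = \sum_i \sum_j M i j.
Proof.
rewrite -sum1_card big_mkcond pair_bigA /=.
by apply: eq_bigr => -[i j] _; rewrite inE; case: (M i j).
Qed.

(** Rows and columns are labelled by blocks, with a one where the labels agree. No line meets two
    blocks and each block is connected, so the blocks are the components. *)
Lemma complete_block_matrix (L : finType) (x y : L -> nat) n m :
    (forall k, [/\ 0 < x k, 0 < y k & 4 <= x k + y k]) ->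
    n = \sum_k x k -> m = \sum_k y k ->
  exists (M : 'M[bool]_(n, m)) (comp : L -> {set 'I_n * 'I_m}),
    [/\ is_kTDS 2 M, #|ones M| = \sum_k x k * y k,
        components M = [set comp k | k in L]
      & forall k, is_J M (comp k) (x k) (y k)].
Proof.
move=> Hxy nE mE.
have [r rE] := exists_labelling nE; have [c cE] := exists_labelling mE.
pose M : 'M[bool]_(n, m) := (\matrix_(i, j) (r i == c j))%R.
have rowE i : row_sum M i = y (r i).
  rewrite /row_sum -cE -sum1_card [RHS]big_mkcond; apply: eq_bigr => j _.
  by rewrite mxE inE eq_sym; case: eqP.
have colE j : col_sum M j = x (c j).
  rewrite /col_sum -rE -sum1_card [RHS]big_mkcond; apply: eq_bigr => i _.
  by rewrite mxE inE; case: eqP.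
have row_ex k : exists i, r i = k.
  have [xk _ _] := Hxy k; move: xk; rewrite -rE card_gt0 => /set0Pn[i].
  by rewrite inE => /eqP; exists i.
have col_ex k : exists j, c j = k.
  have [_ yk _] := Hxy k; move: yk; rewrite -cE card_gt0 => /set0Pn[j].
  by rewrite inE => /eqP; exists j.
pose comp k : {set 'I_n * 'I_m} := [set p | (r p.1 == k) && (c p.2 == k)].
have one_comp p : p \in ones M -> [set q in ones M | connect (Gamma M) p q] = comp (r p.1).
  case: p => i j; rewrite inE mxE /= => /eqP rc; apply/setP => -[i' j'].
  rewrite !inE /= mxE; apply/andP/andP => [[rc' con]|[/eqP ri /eqP cj]].
    (* An edge keeps the row or the column, and both labels of a one agree, so the label is constant
       along paths. *)
    suff E : r i = r i' by rewrite -(eqP rc') E eqxx.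
    case/connectP: con => s; elim: s i j rc => [|[i1 j1] s IH] i j rc /=.
      by move=> _ [->].
    case/andP=> /and4P[_ + _ +] ps ls; rewrite !inE /= mxE => /eqP rc1 step.
    rewrite -(IH _ _ rc1 ps ls); case/orP: step => /andP[/eqP E _].
      by rewrite E.
    by rewrite rc rc1 E.
  have Mij : M i j by rewrite mxE rc.
  have Mij' : M i j' by rewrite mxE cj.
  split; first by rewrite ri cj.
  (* The corner [(i, j')] of the block is a one: go along the row, then along the column. *)
  apply: connect_trans (connect_Gamma_row Mij Mij') _.
  by apply: connect_Gamma_col; rewrite // mxE ri cj.
have rowsE k : comp_rows (comp k) = [set i | r i == k].
  apply/setP => i; rewrite inE; apply/imsetP/idP => [[p]|ri].
    by rewrite inE => /andP[? _] ->.
  by have [j cj] := col_ex k; exists (i, j); rewrite // inE /= ri cj eqxx.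
have colsE k : comp_cols (comp k) = [set j | c j == k].
  apply/setP => j; rewrite inE; apply/imsetP/idP => [[p]|cj].
    by rewrite inE => /andP[_ ?] ->.
  by have [i ri] := row_ex k; exists (i, j); rewrite // inE /= ri cj eqxx.
exists M, comp; split.
- move=> i j; rewrite /kappa rowE colE mxE.
  (* On a one, [kappa] is [x k + y k - 2]; on a zero it is a sum of two positive terms. *)
  by have [_ ? ?] := Hxy (r i); have [? _ _] := Hxy (c j); case: eqP => [<-|_]; lia.
- rewrite card_ones; under eq_bigr => i _ do rewrite -/(row_sum M i) rowE.
  rewrite (partition_big r xpredT) //=; apply: eq_bigr => k _.
  rewrite -rE -sum_nat_const; apply: eq_big => [i|i /eqP -> //].
  by rewrite inE.
- apply/setP => C; apply/imsetP/imsetP => [[p pM ->]|[k _ ->]].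
    by exists (r p.1); rewrite // one_comp.
  have [i ri] := row_ex k; have [j cj] := col_ex k.
  have pM : (i, j) \in ones M by rewrite inE mxE ri cj eqxx.
  by exists (i, j); rewrite // one_comp // ri.
- move=> k; apply: perm_equiv_J => [||i j]; [by rewrite rowsE|by rewrite colsE|].
  have rk a : a \in comp_rows (comp k) -> r a = k by rewrite rowsE inE => /eqP.
  have ck b : b \in comp_cols (comp k) -> c b = k by rewrite colsE inE => /eqP.
  by rewrite !mxE rk ?ck //; exact: enum_valP.
Qed.

(** * Lower bound on the number of ones by weights, and its equality case *)

Lemma row_sum_gt0 n m (M : 'M[bool]_(n, m)) : no_zero_row M -> forall i, 0 < row_sum M i.
Proof. by move=> H i; have [j Mij] := H i; rewrite /row_sum (bigD1 j) //= Mij. Qed.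

Lemma col_sum_gt0 n m (M : 'M[bool]_(n, m)) : no_zero_col M -> forall j, 0 < col_sum M j.
Proof. by move=> H j; have [i Mij] := H j; rewrite /col_sum (bigD1 i) //= Mij. Qed.

Lemma sum_ones_row n m (M : 'M[bool]_(n, m)) (f : 'I_n -> nat) :
  \sum_i \sum_j M i j * f i = \sum_i row_sum M i * f i.
Proof. by apply: eq_bigr => i _; rewrite big_distrl. Qed.

Lemma sum_ones_col n m (M : 'M[bool]_(n, m)) (f : 'I_m -> nat) :
  \sum_i \sum_j M i j * f j = \sum_j col_sum M j * f j.
Proof. by rewrite exchange_big; apply: eq_bigr => j _; rewrite big_distrl. Qed.

Lemma eq_of_leq_sum (I : finType) (f g : I -> nat) :
  (forall i, f i <= g i) -> \sum_i g i <= \sum_i f i -> forall i, f i = g i.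
Proof.
move=> fg le i; apply/eqP; rewrite eqn_leq fg /=.
move: le; rewrite (bigD1 i) //= [X in _ <= X](bigD1 i) //=.
have : \sum_(j | j != i) f j <= \sum_(j | j != i) g j by apply: leq_sum.
lia.
Qed.

Definition weight d := if d == 1 then 6 else if d == 2 then 3 else 2.

Lemma weight_ge d : 0 < d -> 6 <= d * weight d.
Proof. by case: d => [|[|[|d]]] // _; rewrite /weight /=; lia. Qed.

Lemma weight_le a b : 0 < a -> 0 < b -> 4 <= a + b -> weight a + weight b <= 8.
Proof. by case: a b => [|[|[|a]]] [|[|[|b]]] //=; rewrite /weight /=; lia. Qed.

(** Two ends of degree at least 2 give at most 3 + 3, so 8 arises only as 6 + 2. *)
Lemma weight_eq a b : 0 < a -> 0 < b -> 4 <= a + b ->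
  weight a + weight b = 8 -> a = 1 \/ b = 1.
Proof. by case: a b => [|[|[|a]]] [|[|[|b]]] //=; rewrite /weight /=; lia. Qed.

Lemma weight_tight d : 0 < d -> d * weight d = 6 -> d <= 3.
Proof. by case: d => [|[|[|[|d]]]] // _; rewrite /weight /=; lia. Qed.

Section LowerBound.
Variables (n m : nat) (M : 'M[bool]_(n, m)).
Hypotheses (TDS : is_kTDS 2 M) (nzr : no_zero_row M) (nzc : no_zero_col M).

Let r := row_sum M.
Let c := col_sum M.

Lemma one_deg i j : M i j -> 4 <= r i + c j.
Proof.
move=> Mij; have := TDS i j; rewrite /kappa Mij -/(r i) -/(c j); lia.
Qed.

(** The total weight: at least 6 per line when summed over lines, at most 8 per one when summed over
    ones. *)
Let W := \sum_i \sum_j M i j * (weight (r i) + weight (c j)).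

Lemma W_eq : W = \sum_i r i * weight (r i) + \sum_j c j * weight (c j).
Proof.
rewrite -(sum_ones_row M (fun i => weight (r i))) -(sum_ones_col M (fun j => weight (c j))).
rewrite -big_split; apply: eq_bigr => i _ /=; rewrite -big_split.
by apply: eq_bigr => j _ /=; rewrite mulnDr.
Qed.

Lemma W_entry i j : M i j * (weight (r i) + weight (c j)) <= M i j * 8.
Proof.
case Mij: (M i j) => //; rewrite !mul1n.
by apply: weight_le; [exact: row_sum_gt0|exact: col_sum_gt0|exact: one_deg].
Qed.

Lemma sum_ones8 : \sum_i \sum_j M i j * 8 = 8 * #|ones M|.
Proof.
by rewrite card_ones mulnC big_distrl; apply: eq_bigr => i _; rewrite big_distrl.
Qed.

Lemma W_le : W <= 8 * #|ones M|.
Proof.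
by rewrite -sum_ones8; apply: leq_sum => i _; apply: leq_sum => j _; exact: W_entry.
Qed.

Lemma rows_ge : \sum_(i < n) 6 <= \sum_i r i * weight (r i).
Proof. by apply: leq_sum => i _; apply/weight_ge/row_sum_gt0. Qed.

Lemma cols_ge : \sum_(j < m) 6 <= \sum_j c j * weight (c j).
Proof. by apply: leq_sum => j _; apply/weight_ge/col_sum_gt0. Qed.

Lemma card_ones_ge : 3 * (n + m) <= 4 * #|ones M|.
Proof.
have := W_le; have := rows_ge; have := cols_ge.
rewrite !sum_nat_const !card_ord W_eq; lia.
Qed.

(* In the tight case every one has degrees {1, 3}; double counting the ones
   with [4 - r i = c j] then gives 3n = sum of c j ^ 2, and odd squares are
   1 modulo 8. *)
Lemma card_ones_tight : 3 * (n + m) = 4 * #|ones M| -> 3 * n = m %[mod 8].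
Proof.
move=> tight.
have W_ge : 8 * #|ones M| <= W.
  by have := rows_ge; have := cols_ge; rewrite !sum_nat_const !card_ord W_eq; lia.
have r_tight i : 6 = r i * weight (r i).
  apply: (@eq_of_leq_sum _ (fun=> 6) (fun i => r i * weight (r i))).
    by move=> i'; apply/weight_ge/row_sum_gt0.
  by have := W_le; have := cols_ge; rewrite W_eq !sum_nat_const !card_ord; lia.
have c_tight j : 6 = c j * weight (c j).
  apply: (@eq_of_leq_sum _ (fun=> 6) (fun j => c j * weight (c j))).
    by move=> j'; apply/weight_ge/col_sum_gt0.
  by have := W_le; have := rows_ge; rewrite W_eq !sum_nat_const !card_ord; lia.
have one_tight i j : M i j -> weight (r i) + weight (c j) = 8.
  have := @eq_of_leq_sum _ (fun p : 'I_n * 'I_m => M p.1 p.2 * (weight (r p.1) + weight (c p.2)))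
           (fun p => M p.1 p.2 * 8) (fun p => W_entry p.1 p.2).
  rewrite -(pair_bigA _ (fun i j => M i j * 8)) sum_ones8.
  rewrite -(pair_bigA _ (fun i j => M i j * (weight (r i) + weight (c j)))).
  by move=> /(_ W_ge (i, j)) /= + Mij; rewrite Mij !mul1n.
have r0 := row_sum_gt0 nzr; have c0 := col_sum_gt0 nzc.
have r3 i : r i <= 3 by apply: weight_tight; [exact: r0|rewrite -r_tight].
have c3 j : c j <= 3 by apply: weight_tight; [exact: c0|rewrite -c_tight].
have one4 i j : M i j -> 4 - r i = c j.
  move=> Mij; have := weight_eq (r0 i) (c0 j) (one_deg Mij) (one_tight _ _ Mij).
  have := one_deg Mij; have := r3 i; have := c3 j; rewrite -/(r i) -/(c j); lia.
(* Each row contains a one, so its sum is 1 or 3, and [r i * (4 - r i)] is 3 for both. *)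
have r_odd i : r i * (4 - r i) = 3.
  have [j Mij] := nzr i; have := one4 _ _ Mij; have := r3 i; have := c3 j.
  have := weight_eq (r0 i) (c0 j) (one_deg Mij) (one_tight _ _ Mij).
  rewrite -/(r i) -/(c j); case: (r i) => [|[|[|[|]]]] //; lia.
have c_odd j : c j * c j = 1 %[mod 8].
  have [i Mij] := nzc j; have := one4 _ _ Mij; have := r_odd i; have := r3 i.
  by case: (r i) => [|[|[|[|]]]] // _ _ <-.
have : \sum_i r i * (4 - r i) = \sum_j c j * c j.
  rewrite -(sum_ones_row M (fun i => 4 - r i)) -(sum_ones_col M c).
  by apply: eq_bigr => i _; apply: eq_bigr => j _; case Mij: (M i j); rewrite // (one4 _ _ Mij).
under eq_bigr do rewrite r_odd.
rewrite sum_nat_const card_ord mulnC => ->.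
rewrite -modn_summ; under eq_bigr do rewrite c_odd.
by rewrite modn_summ sum1_card card_ord.
Qed.
End LowerBound.

(** * The ceiling as a natural quotient, upper bounds on the minimum, and small sizes *)

Lemma ceil_three_quarters k : Num.ceil (3 * k%:R / 4 : rat)%R = Posz ((3 * k + 3) %/ 4).
Proof.
apply: Num.Theory.ceil_def.
set q := (3 * k + 3) %/ 4.
have q1 : (4 * q%:R < 3 * k%:R + 4 :> rat)%R by rewrite -!natrM -natrD ltr_nat /q; lia.
have q2 : (3 * k%:R <= 4 * q%:R :> rat)%R by rewrite -!natrM ler_nat /q; lia.
rewrite rmorphB /= -pmulrn.
apply/andP; split; lra.
Qed.

(** With two full rows, [kappa] is [m] on ones and 2 on zeros. *)
Lemma TDS_two_rows n m : 1 < n -> 1 < m ->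
  exists2 M : 'M[bool]_(n, m), is_kTDS 2 M & #|ones M| = 2 * m.
Proof.
case: n => [|[|n]] // _ hm.
pose M : 'M[bool]_(n.+2, m) := (\matrix_(i, j) (i < 2)%N)%R.
have colE j : col_sum M j = 2.
  rewrite /col_sum !big_ord_recl big1 => [|i _]; by rewrite !mxE.
exists M.
  move=> i j; rewrite /kappa colE mxE /row_sum.
  under eq_bigr do rewrite mxE.
  by rewrite sum_nat_const card_ord; case: (i < 2); lia.
rewrite card_ones exchange_big; under eq_bigr => j _ do rewrite -/(col_sum M j) colE.
by rewrite sum_nat_const card_ord mulnC.
Qed.

Lemma row_sum_tr n m (M : 'M[bool]_(n, m)) j : row_sum M^T%R j = col_sum M j.
Proof. by apply: eq_bigr => i _; rewrite mxE. Qed.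

Lemma col_sum_tr n m (M : 'M[bool]_(n, m)) i : col_sum M^T%R i = row_sum M i.
Proof. by apply: eq_bigr => j _; rewrite mxE. Qed.

Lemma kTDS_tr k n m (M : 'M[bool]_(n, m)) : is_kTDS k M -> is_kTDS k M^T%R.
Proof.
move=> H i j; have := H j i.
by rewrite /kappa row_sum_tr col_sum_tr mxE addnC.
Qed.

Lemma card_ones_tr n m (M : 'M[bool]_(n, m)) : #|ones M^T%R| = #|ones M|.
Proof. by rewrite !card_ones exchange_big; do 2!apply: eq_bigr => ? _; rewrite mxE. Qed.

Lemma min_kTDS_tr k n m (M : 'M[bool]_(n, m)) : is_min_kTDS k M -> is_min_kTDS k M^T%R.
Proof.
case=> TDS le; split; first exact: kTDS_tr.
by move=> M' /kTDS_tr /le; rewrite !card_ones_tr.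
Qed.

Lemma no_zero_row_tr n m (M : 'M[bool]_(n, m)) : no_zero_col M -> no_zero_row M^T%R.
Proof. by move=> H j; have [i Mij] := H j; exists i; rewrite mxE. Qed.

Lemma no_zero_col_tr n m (M : 'M[bool]_(n, m)) : no_zero_row M -> no_zero_col M^T%R.
Proof. by move=> H j; have [i Mij] := H j; exists i; rewrite mxE. Qed.

Lemma min_2TDS_le n m (M : 'M[bool]_(n, m)) : 1 < n -> 1 < m ->
  is_min_kTDS 2 M -> #|ones M| <= 2 * m.
Proof. by move=> hn hm [_ le]; have [M' /le ? <-] := TDS_two_rows hn hm. Qed.

(** Without zero columns all [m] entries are ones, whereas three ones in the row already make a 2TDS
    matrix. *)
Lemma min_2TDS_one_row m (M : 'M[bool]_(1, m)) : 2 < m ->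
  is_min_kTDS 2 M -> no_zero_col M -> m = 3.
Proof.
move=> hm [TDS le] nzc.
have colE (A : 'M[bool]_(1, m)) j : col_sum A j = A ord0 j by rewrite /col_sum big_ord1.
have : #|ones M| = m.
  rewrite card_ones exchange_big -[RHS]card_ord -sum1_card; apply: eq_bigr => j _.
  by have [i] := nzc j; rewrite (ord1 i) big_ord1 => ->.
pose A : 'M[bool]_(1, m) := (\matrix_(i, j) (j < 3)%N)%R.
have rowE i : row_sum A i = 3.
  rewrite /row_sum; under eq_bigr do rewrite mxE.
  case: m hm @A {colE TDS le nzc M} => [|[|[|m]]] // _ _.
  by rewrite !big_ord_recl big1.
have : #|ones M| <= #|ones A|.
  by apply: le => i j; rewrite /kappa rowE colE (ord1 i) !mxE; case: (j < 3).
rewrite (card_ones A) big_ord1 -/(row_sum A ord0) rowE; lia.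
Qed.

Lemma no_min_2TDS_2_3 (M : 'M[bool]_(2, 3)) :
  is_min_kTDS 2 M -> no_zero_row M -> ~ no_zero_col M.
Proof.
case=> TDS le nzr nzc.
have : #|ones M| <= 4.
  (* Two full columns, obtained by transposition, cost 4 ones; two full rows would cost 6. *)
  have [M' /kTDS_tr T' c'] := @TDS_two_rows 3 2 isT isT.
  by have := le _ T'; rewrite card_ones_tr c'.
have rr := row_sum_gt0 nzr; have cc := col_sum_gt0 nzc.
pose i1 : 'I_2 := lift ord0 ord0; pose j1 : 'I_3 := lift ord0 ord0.
pose j2 : 'I_3 := lift ord0 (lift ord0 ord0).
move: (cc ord0) (cc j1) (cc j2) (rr ord0) (rr i1).
move: (TDS ord0 ord0) (TDS ord0 j1) (TDS ord0 j2) (TDS i1 ord0) (TDS i1 j1) (TDS i1 j2).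
rewrite card_ones /kappa /row_sum /col_sum !big_ord_recl !big_ord0 -/i1 -/j1 -/j2.
by case: (M _ _); case: (M _ _); case: (M _ _); case: (M _ _); case: (M _ _); case: (M _ _).
Qed.

(** * Disjoint unions of stars with a prescribed list of exceptional ones *)

Definition star_shape a b (T : finType) (s : T -> nat * nat)
    (k : ('I_a + 'I_b) + T) : nat * nat :=
  match k with
  | inl (inl _) => (1, 3)
  | inl (inr _) => (3, 1)
  | inr t => s t
  end.

Lemma sum_star_shape a b (T : finType) (s : T -> nat * nat)
    (f : nat * nat -> nat) :
  \sum_k f (@star_shape a b T s k)
    = a * f (1, 3) + b * f (3, 1) + \sum_t f (s t).
Proof. by rewrite !big_sumType /= !sum_nat_const !card_ord. Qed.

Lemma star_matrix a b (T : finType) (s : T -> nat * nat) n m :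
    (forall t, [/\ 0 < (s t).1, 0 < (s t).2 & 4 <= (s t).1 + (s t).2]) ->
    n = a + b * 3 + \sum_t (s t).1 -> m = a * 3 + b + \sum_t (s t).2 ->
  exists (M : 'M[bool]_(n, m)) (comp : T -> {set 'I_n * 'I_m}),
    [/\ is_kTDS 2 M,
        #|ones M| = 3 * a + 3 * b + \sum_t (s t).1 * (s t).2,
        forall t, comp t \in components M /\ is_J M (comp t) (s t).1 (s t).2
      & all_J13_J31_except M [set comp t | t in T]].
Proof.
move=> Hs nE mE; pose sh := @star_shape a b T s.
have Hsh k : [/\ 0 < (sh k).1, 0 < (sh k).2 & 4 <= (sh k).1 + (sh k).2].
  by case: k => [[|]|] //= t; exact: Hs.
have [||M [comp [TDS cM compE JE]]] :=
  @complete_block_matrix _ (fun k => (sh k).1) (fun k => (sh k).2) n m Hsh.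
- by rewrite (@sum_star_shape a b T s fst) nE /= muln1.
- by rewrite (@sum_star_shape a b T s snd) mE /= muln1.
exists M, (fun t => comp (inr t)); split=> //.
- by rewrite cM (@sum_star_shape a b T s (fun p => p.1 * p.2)) /=; lia.
- by move=> t; split; [rewrite compE imset_f|exact: (JE (inr t))].
move=> C; rewrite compE inE => /andP[Ct /imsetP[[[k|k]|t] _ CE]]; rewrite CE.
- by left; exact: (JE (inl (inl k))).
- by right; exact: (JE (inl (inr k))).
- by rewrite CE imset_f in Ct.
Qed.

(** The pairs are block sizes, and the four lists mirror the four alternatives of [Jcomponents]. *)
Inductive exceptional : seq (nat * nat) -> Prop :=
| Exceptional_nil : exceptional [::]
| Exceptional_col x of 4 <= x <= 7 : exceptional [:: (x, 1)]
| Exceptional_row y of 4 <= y <= 7 : exceptional [:: (1, y)]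
| Exceptional_col_row x y of 4 <= x <= 5 & 4 <= y <= 5 :
    exceptional [:: (x, 1); (1, y)].

Lemma Jcomponents_matrix a b (e : seq (nat * nat)) n m :
    exceptional e ->
    n = a + b * 3 + sumn (unzip1 e) -> m = a * 3 + b + sumn (unzip2 e) ->
  exists M : 'M[bool]_(n, m),
    [/\ is_kTDS 2 M, Jcomponents M
      & #|ones M| = 3 * a + 3 * b + sumn [seq p.1 * p.2 | p <- e]].
Proof.
move=> eE nE mE.
(* The default [(0, 0)] is never read, as [t] is below [size e]. *)
pose s (t : 'I_(size e)) := nth (0, 0) e t.
have sumE (f : nat * nat -> nat) : \sum_t f (s t) = sumn (map f e).
  by rewrite sumnE big_map (big_nth (0, 0)) big_mkord.
have Hs t : [/\ 0 < (s t).1, 0 < (s t).2 & 4 <= (s t).1 + (s t).2].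
  have /(all_nthP (0, 0)) : all (fun p => [&& 0 < p.1, 0 < p.2 & 4 <= p.1 + p.2]) e.
    by case: eE => [|x hx|y hy|x y hx hy] /=; lia.
  by move=> /(_ t (ltn_ord t)) /and3P.
have [||M [comp [TDS cM compJ exc]]] := @star_matrix a b _ s n m Hs.
- by rewrite nE (sumE fst).
- by rewrite mE (sumE snd).
exists M; split=> //; last by rewrite cM (sumE (fun p => p.1 * p.2)).
case: eE @s comp compJ exc {Hs nE mE cM sumE}
  => [|x hx|y hy|x y hx hy] s comp compJ exc.
- apply: Or41; suff <- : [set comp t | t in 'I_0] = set0 by [].
  by apply/setP => C; rewrite inE; apply/negP => /imsetP[[]].
- apply: Or42; have [c0 J0] := compJ ord0; exists (comp ord0), x; split=> //.
  suff <- : [set comp t | t in 'I_1] = [set comp ord0] by [].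
  by apply/setP => C; rewrite inE; apply/imsetP/eqP => [[t _ ->]|->];
     [rewrite (ord1 t)|exists ord0].
- apply: Or43; have [c0 J0] := compJ ord0; exists (comp ord0), y; split=> //.
  suff <- : [set comp t | t in 'I_1] = [set comp ord0] by [].
  by apply/setP => C; rewrite inE; apply/imsetP/eqP => [[t _ ->]|->];
     [rewrite (ord1 t)|exists ord0].
- apply: Or44; have [c0 J0] := compJ ord0; have [c1 J1] := compJ ord_max.
  exists (comp ord0), (comp ord_max), x, y; split=> //.
  suff <- : [set comp t | t in 'I_2] = [set comp ord0; comp ord_max] by [].
  apply/setP => C; rewrite !inE; apply/imsetP/orP => [[t _ ->]|].
    by case: t => -[|[|]] // i; [left|right]; apply/eqP; congr comp; apply: val_inj.
  by case=> /eqP ->; [exists ord0|exists ord_max].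
Qed.

(** * Arithmetic choice of the stars *)

(** The excess [4 * N' - 3 * (n + m)] is 0 for a star with 3 ones, 1 with 4 and 2 with 5. A total
    excess below 4 attains the rounded-up bound; it is 4 only when two stars with 5 ones occur, and
    there [tight] excludes equality for [N], so one more one is unavoidable. The bounds [N <= 2 * n]
    and [N <= 2 * m] keep [n] and [m] balanced, so that the counts are not negative. *)
Lemma exists_star_counts n m N :
    1 < n -> 1 < m ->
    (n, m) \notin [:: (2, 2); (2, 3); (3, 2); (3, 3); (3, 4); (4, 3)] ->
    3 * (n + m) <= 4 * N -> (3 * (n + m) = 4 * N -> 3 * n = m %[mod 8]) ->
    N <= 2 * n -> N <= 2 * m ->
  exists a b e,
    let N' := 3 * a + 3 * b + sumn [seq p.1 * p.2 | p <- e] in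
    [/\ exceptional e,
        n = a + b * 3 + sumn (unzip1 e), m = a * 3 + b + sumn (unzip2 e),
        N' <= N & N' = (3 * (n + m) + 3) %/ 4 + (m == 3 * n + 4 %[mod 8])].
Proof.
move=> n1 m1; rewrite !inE !xpair_eqE !negb_or.
case/and5P=> h22 h23 h32 h33 /andP[h34 h43] le3 tight le_n le_m.
(* A J(1,3) adds 0 and a J(3,1) adds 8 to 3n - m, so the exceptional stars
   are dictated by s. *)
have [q [s [s8 nE]]] : exists q s, s < 8 /\ 3 * n = m + 8 * q + s.
  by exists ((3 * n - m) %/ 8), ((3 * n - m) %% 8); lia.
have -> : (m == 3 * n + 4 %[mod 8]) = (s == 4) by clear - s8 nE; lia.
have {}tight : 3 * (n + m) = 4 * N -> s = 0 by clear - s8 nE tight; lia.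
have {nE}mE : m = 3 * n - 8 * q - s by lia.
have lt : 8 * q + s < 3 * n by lia.
move: s s8 mE lt tight => [|[|[|[|[|[|[|[|//]]]]]]]] _ mE lt tight; subst m.
(* To 3n - m, J(4,1) adds 11, J(5,1) adds 14, J(1,4) adds -1 and J(1,5) adds -2. The total must be s
   modulo 8; the quotient then fixes [b], and n fixes [a]. *)
- exists (n - 3 * q), q, [::] => /=; split; [by constructor|..]; lia.
- exists (n - 3 * q - 2), (q - 1), [:: (4, 1); (1, 5)] => /=; split; [by constructor|..]; lia.
- exists (n - 3 * q - 2), (q - 1), [:: (4, 1); (1, 4)] => /=; split; [by constructor|..]; lia.
- exists (n - 3 * q - 1), (q - 1), [:: (4, 1)] => /=; split; [by constructor|..]; lia.
- exists (n - 3 * q - 3), (q - 1), [:: (5, 1); (1, 5)] => /=; split; [by constructor|..]; lia.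
- exists (n - 3 * q - 3), (q - 1), [:: (5, 1); (1, 4)] => /=; split; [by constructor|..]; lia.
(* Both 14 and -2 are 6 modulo 8. If m <= n, then q >= 1 since (3,3) is excluded, which allows [b]
   to be q - 1; otherwise n >= 4q + 4, which leaves room for [a]. *)
- have [mn|nm] := leqP (3 * n - 8 * q - 6) n.
    exists (n - 3 * q - 2), (q - 1), [:: (5, 1)] => /=; split; [by constructor|..]; lia.
  exists (n - 3 * q - 4), (q + 1), [:: (1, 5)] => /=; split; [by constructor|..]; lia.
- exists (n - 3 * q - 4), (q + 1), [:: (1, 4)] => /=; split; [by constructor|..]; lia.
Qed.

Theorem theorem8 (n m : nat) (hn : 1 <= n) (hm : 1 <= m)
  (hnm : (n, m) \notin
     [:: (1, 1); (1, 2); (2, 1); (2, 2); (3, 3); (3, 4); (4, 3)])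
  (hM0 : exists M0 : 'M[bool]_(n, m),
     [/\ is_min_kTDS 2 M0, no_zero_row M0 & no_zero_col M0]) :
  exists M : 'M[bool]_(n, m),
    [/\ is_min_kTDS 2 M,
        Jcomponents M
      & Posz #|ones M| =
          (Num.ceil (3 * (n + m)%N%:R / 4 : rat)
           + (if m == 3 * n + 4 %[mod 8] then 1 else 0)%N%:Z)%R].
Proof.
case: hM0 => M0 [minM0 nzr nzc]; have [TDS0 le0] := minM0.
have ge := card_ones_ge TDS0 nzr nzc.
(* A star matrix with at most as many ones as [M0] is itself minimum, so only the counts remain to
   be found. *)
suff [a [b [e [eE nE mE leN NE]]]] : exists a b e,
    let N' := 3 * a + 3 * b + sumn [seq p.1 * p.2 | p <- e] in
    [/\ exceptional e,
        n = a + b * 3 + sumn (unzip1 e), m = a * 3 + b + sumn (unzip2 e),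
        N' <= #|ones M0|
      & N' = (3 * (n + m) + 3) %/ 4 + (m == 3 * n + 4 %[mod 8])].
  have [M [TDS JM cM]] := Jcomponents_matrix eE nE mE.
  exists M; split=> //.
    by split=> // M' /le0; apply: leq_trans; rewrite cM.
  by rewrite ceil_three_quarters cM NE PoszD; case: ifP.
move: hnm; rewrite !inE !xpair_eqE !negb_or => hnm.
have [n1|n1] := leqP n 1.
  have nE : n = 1 by lia.
  subst n; have mE : m = 3 by apply: min_2TDS_one_row minM0 nzc; lia.
  (* A single J(1,3); multiplied by 4, the inequality 3 <= [#|ones M0|] is the lower bound [ge]. *)
  by subst m; exists 1, 0, [::]; split=> //;
      [by constructor|by rewrite -(leq_pmul2l (isT : 0 < 4))].
have [m1|m1] := leqP m 1.
  have mE : m = 1 by lia.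
  subst m; have nE : n = 3.
    by apply: min_2TDS_one_row (min_kTDS_tr minM0) (no_zero_col_tr nzr); lia.
  by subst n; exists 0, 1, [::]; split=> //;
      [by constructor|by rewrite -(leq_pmul2l (isT : 0 < 4))].
apply: exists_star_counts => //.
- have h23 : ~ (n = 2 /\ m = 3).
    by case=> ? ?; subst n m; exact: no_min_2TDS_2_3 minM0 nzr nzc.
  have h32 : ~ (n = 3 /\ m = 2).
    case=> ? ?; subst n m.
    exact: no_min_2TDS_2_3 (min_kTDS_tr minM0) (no_zero_row_tr nzc) (no_zero_col_tr nzr).
  by rewrite !inE !xpair_eqE !negb_or; clear -hnm h23 h32; lia.
- exact: card_ones_tight.
- by rewrite -(card_ones_tr M0); apply: min_2TDS_le (min_kTDS_tr minM0).
- exact: min_2TDS_le minM0.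
Qed.
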